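(* Fix an equation $(f,q,w)$ as in the context. For $a_{12},b_{21}\in\mathbb R$ and a fixed $z\in\mathbb C$ let $\mathbf A(a_{12},b_{21})$ be the self-adjoint boundary condition with coefficient matrix $\begin{pmatrix}1&a_{12}&\bar z&0\\0&z&b_{21}&1\end{pmatrix}$, and let $\mathbf S_1=\begin{pmatrix}0&1&0&0\\0&0&b_{21}&1\end{pmatrix}$, $\mathbf S_2=\begin{pmatrix}1&a_{12}&0&0\\0&0&1&0\end{pmatrix}$. Then the problem with $\mathbf A(a_{12},b_{21})$ has exactly $N$ eigenvalues if $a_{12}\ne1/f_0$ and exactly $N-1$ if $a_{12}=1/f_0$; with $\mathbf S_1$ it has exactly $N$ eigenvalues; with $\mathbf S_2$ it has exactly $N-1$ eigenvalues if $a_{12}\neq1/f_0$ and exactly $N-2$ if $a_{12}=1/f_0$. Further: (i) fix $b_{21}$ and let $a^{(1)}<a^{(2)}\le1/f_0<a^{(3)}<a^{(4)}$; writing $\lambda_n(a^{(i)})$ for the eigenvalues with $\mathbf A(a^{(i)},b_{21})$ and $\lambda_n(\mathbf S_1)$ for those with $\mathbf S_1$: for each $0\le n\le N-2$, $\lambda_n(a^{(3)})\le\lambda_n(a^{(4)})\le\lambda_n(\mathbf S_1)\le\lambda_n(a^{(1)})\le\lambda_n(a^{(2)})\le\lambda_{n+1}(a^{(3)})$, and $\lambda_{N-1}(a^{(3)})\le\lambda_{N-1}(a^{(4)})\le\lambda_{N-1}(\mathbf S_1)\le\lambda_{N-1}(a^{(1)})$; in addition $\lambda_{N-1}(a^{(1)})\le\lambda_{N-1}(a^{(2)})$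 if $a^{(2)}<1/f_0$; (ii) fix $a_{12}$ and let $b^{(1)}<b^{(2)}$; writing $\lambda_n(b^{(j)})$ for the eigenvalues with $\mathbf A(a_{12},b^{(j)})$ and $\lambda_n(\mathbf S_2)$ for those with $\mathbf S_2$: for each $0\le n\le N-3$, $\lambda_n(b^{(1)})\le\lambda_n(b^{(2)})\le\lambda_n(\mathbf S_2)\le\lambda_{n+1}(b^{(1)})$, and $\lambda_{N-2}(b^{(1)})\le\lambda_{N-2}(b^{(2)})$; in addition, if $a_{12}\neq1/f_0$, then $\lambda_{N-2}(b^{(2)})\le\lambda_{N-2}(\mathbf S_2)\le\lambda_{N-1}(b^{(1)})\le\lambda_{N-1}(b^{(2)})$.
   Context: Let $N\ge2$ be an integer. An equation is given by real sequences $f=\{f_n\}_{n=0}^N$, $q=\{q_n\}_{n=1}^N$, $w=\{w_n\}_{n=1}^N$ with $f_n\neq0$, $w_n>0$; it is $-\nabla(f_n\Delta y_n)+q_ny_n=\lambda w_ny_n$, $1\le n\le N$, for $y=\{y_n\}_{n=0}^{N+1}$, $\Delta y_n=y_{n+1}-y_n$, $\nabla y_n=y_n-y_{n-1}$. A boundary condition with $2\times4$ coefficient matrix $(A,B)$ (rank 2) is $A(y_0,f_0\Delta y_0)^T+B(y_N,f_N\Delta y_N)^T=0$; matrices differing by left multiplication by an invertible $2\times2$ complex matrix give the same condition. Eigenvalues ($\lambda$ with a nontrivial solution) of a self-adjoint problem are real; multiplicity = dimension of the solution space (equal to the multiplicity as a zero of the characteristic polynomial); counted with multiplicity they are ordered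 $\lambda_0\le\lambda_1\le\cdots$, and ''exactly $k$ eigenvalues'' counts multiplicity. *)

(* Defs.v *)
From HB Require Import structures.
From mathcomp Require Import all_boot all_order all_algebra.
From mathcomp Require Import reals.
From mathcomp Require Export complex.
Set Implicit Arguments. Unset Strict Implicit. Unset Printing Implicit Defensive.
Import Order.TTheory GRing.Theory Num.Theory.
Local Open Scope ring_scope.
Local Open Scope complex_scope.

Section DSL.
Variable R : realType.
Local Notation C := R[i].

(* The equation (f, q, w): f_0..f_N, q_1..q_N, w_1..w_N (values of the
   sequences outside these ranges are irrelevant). A solution is
   y = (y_0, ..., y_{N+1}) stored as a row vector of length N+2. *)
Variables (N : nat) (f q w : nat -> R).

Definition yv (y : 'rV[C]_(N.+2)) (k : nat) : C := y 0 (inord k).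

Definition dlt (y : 'rV[C]_(N.+2)) (k : nat) : C := yv y k.+1 - yv y k.

(* residual of  -nabla(f_n Delta y_n) + q_n y_n - lambda w_n y_n  at n *)
Definition eq_res (lam : C) (y : 'rV[C]_(N.+2)) (n : nat) : C :=
  - ((f n)%:C * dlt y n - (f n.-1)%:C * dlt y n.-1)
  + (q n)%:C * yv y n - lam * (w n)%:C * yv y n.

Definition bvec (y : 'rV[C]_(N.+2)) : 'cV[C]_4 :=
  \col_(j < 4) nth 0 [:: yv y 0; (f 0)%:C * dlt y 0;
                         yv y N; (f N)%:C * dlt y N] j.

(* The full system (N difference equations for 1 <= n <= N, then the two
   rows of the boundary condition (A,B)(bvec y) = 0), as a linear map. *)
Definition res_map (AB : 'M[C]_(2,4)) (lam : C) (y : 'rV[C]_(N.+2))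
  : 'rV[C]_(N.+2) :=
  \row_(i < N.+2)
    (if (i < N)%N then eq_res lam y i.+1
     else (AB *m bvec y) (inord (i - N)) 0).

Definition sol_space (AB : 'M[C]_(2,4)) (lam : C) :=
  kermx (lin1_mx (res_map AB lam)).

Definition mult (AB : 'M[C]_(2,4)) (lam : C) : nat := \rank (sol_space AB lam).

Definition is_eigenvalue (AB : 'M[C]_(2,4)) (lam : C) : Prop :=
  (0 < mult AB lam)%N.

(* s is the nondecreasing list lambda_0 <= lambda_1 <= ... of all the
   eigenvalues, which are real, each repeated according to multiplicity. *)
Definition eig_list (AB : 'M[C]_(2,4)) (s : seq R) : Prop :=
  sorted <=%R s /\
  forall lam : C, count_mem lam (map (fun x : R => x%:C) s) = mult AB lam.

Definition has_exactly (AB : 'M[C]_(2,4)) (k : nat) : Prop :=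
  exists s, eig_list AB s /\ size s = k.

End DSL.

Definition bcA (R : realType) (z : R[i]) (a12 b21 : R) : 'M[R[i]]_(2,4) :=
  \matrix_(i < 2, j < 4)
    nth 0 (nth [::] [:: [:: 1; a12%:C; z^*; 0]; [:: 0; z; b21%:C; 1]] i) j.

Definition bcS1 (R : realType) (b21 : R) : 'M[R[i]]_(2,4) :=
  \matrix_(i < 2, j < 4)
    nth 0 (nth [::] [:: [:: 0; 1; 0; 0]; [:: 0; 0; b21%:C; 1]] i) j.

Definition bcS2 (R : realType) (a12 : R) : 'M[R[i]]_(2,4) :=
  \matrix_(i < 2, j < 4)
    nth 0 (nth [::] [:: [:: 1; a12%:C; 0; 0]; [:: 0; 0; 1; 0]] i) j.

(* Main.v *)
Require Import Defs.
From HB Require Import structures.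
From mathcomp Require Import all_boot all_order all_algebra.
From mathcomp Require Import reals complex ring zify.
Set Implicit Arguments. Unset Strict Implicit. Unset Printing Implicit Defensive.
Import Order.TTheory GRing.Theory Num.Theory.
Local Open Scope ring_scope.
Local Open Scope complex_scope.
Local Open Scope sesquilinear_scope.

(** Eliminating y_0 and y_(N+1), a problem with boundary condition A, S1 or S2
    becomes a Hermitian eigenvalue problem for x = (y_1, ..., y_N), relative to
    the weight w: the form
      J(x) + alpha |x_1 + conj(z) x_N|^2 + beta |x_N|^2,
    with J independent of the boundary condition, on the subspace cut out by
    x_1 + conj(z) x_N = 0 (if p holds) and x_N = 0 (if r holds). Put
    c = 1 / f_0 - a_12. Then
      A  is  alpha = 1 / c (p holds iff c = 0),  beta = b_21, r fails;
      S1 is  alpha = 0,     p fails,             beta = b_21, r fails;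
      S2 is  alpha = 1 / c (p holds iff c = 0),  r holds.
    The number of eigenvalues is the dimension of the subspace, and every
    inequality is an instance of the Courant-Fischer comparison of two forms
    that are ordered on a common subspace: the codimension of that subspace in
    the domain of the larger form is the shift of the index. *)

(** * Simultaneous diagonalization on a subspace *)

(** The rows of [P] are [W]-orthonormal and the form of [H] is diagonal on them, so [d] lists the
    eigenvalues, relative to [W], of the compression of [H] to the row space of [P]. *)
Definition diagonalizes (R : rcfType) k n (W H : 'M[R[i]]_n)
    (P : 'M[R[i]]_(k, n)) (d : 'rV[R]_k) : Prop :=
  P *m W *m P^t* = 1%:M /\ P *m H *m P^t* = diag_mx (map_mx (real_complex R) d).

Lemma trmxC_mul (C : numClosedFieldType) m n p (A : 'M[C]_(m, n))
    (B : 'M[C]_(n, p)) : (A *m B)^t* = B^t* *m A^t*.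
Proof. by rewrite trmx_mul map_mxM. Qed.

Lemma trmxC_real_diag (R : rcfType) n (d : 'rV[R]_n) :
  (diag_mx (map_mx (real_complex R) d))^t* = diag_mx (map_mx (real_complex R) d).
Proof.
apply/matrixP => i j; rewrite !mxE; case: (eqVneq i j) => [->|_].
  by rewrite !mulr1n; apply/CrealP/complex_realP; exists (d 0 j).
by rewrite !mulr0n conjC0.
Qed.

Lemma hermsymmxP (C : numClosedFieldType) n (A : 'M[C]_n) :
  reflect (A^t* = A) (A \is hermsymmx).
Proof.
by apply: (iffP (is_hermitianmxP _ _ _)); rewrite expr0 scale1r => /esym.
Qed.

Lemma exists_diagonalizes (R : rcfType) n m (w : 'rV[R]_n) (H : 'M[R[i]]_n)
    (V : 'M[R[i]]_(m, n)) :
  (forall i, 0 < w 0 i) -> H^t* = H ->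
  exists (P : 'M_(\rank V, n)) d,
    diagonalizes (diag_mx (map_mx (real_complex R) w)) H P d /\ (P :=: V)%MS.
Proof.
move=> w0 Hh.
(* In the coordinates x T the weight becomes the identity, so an orthonormal
   basis Q of V T followed by a spectral rotation U does the job. *)
pose T : 'M[R[i]]_n :=
  diag_mx (map_mx (real_complex R) (\row_i Num.sqrt (w 0 i))).
pose S : 'M[R[i]]_n :=
  diag_mx (map_mx (real_complex R) (\row_i (Num.sqrt (w 0 i))^-1)).
have sq i : Num.sqrt (w 0 i) != 0 by rewrite gt_eqF// sqrtr_gt0.
have ST : S *m T = 1%:M.
  rewrite mulmx_diag -diag_const_mx; congr diag_mx.
  by apply/rowP=> i; rewrite !mxE -rmorphM /= mulVf.
have TS : T *m S = 1%:M by apply: mulmx1C.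
have SWS : S *m diag_mx (map_mx (real_complex R) w) *m S = 1%:M.
  rewrite !mulmx_diag -diag_const_mx; congr diag_mx.
  apply/rowP=> i; rewrite !mxE -!rmorphM /=.
  rewrite -[w 0 i](sqr_sqrtr (ltW (w0 i))) sqrtr_sqr ger0_norm ?sqrtr_ge0//.
  by rewrite expr2 mulKf// mulfV.
have Sh : S^t* = S by apply: trmxC_real_diag.
have Tu : row_free T by rewrite row_free_unit; case/mulmx1_unit: TS.
have Su : row_full S by rewrite row_full_unit; case/mulmx1_unit: TS.
pose Q := schmidt (row_base V *m T).
have Qf : row_free (row_base V *m T).
  by rewrite /row_free mxrankMfree// eq_row_base.
have QE : (Q :=: row_base V *m T)%MS by apply: eqmx_schmidt_free.
have Qu : Q *m Q^t* = 1%:M.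
  by apply/unitarymxP/schmidt_unitarymx/rank_leq_col.
pose A := Q *m S *m H *m S *m Q^t*.
have Ah : A \is hermsymmx.
  by apply/hermsymmxP; rewrite /A !trmxC_mul trmxCK Sh Hh !mulmxA.
have /orthomx_spectralP AE := hermitian_normalmx Ah.
have Uu := spectral_unitarymx A.
have Uunit := spectral_unit A.
pose U := spectralmx A; rewrite -/U in AE Uu Uunit.
have UU : U *m U^t* = 1%:M by apply/unitarymxP.
have dr := hermitian_spectral_diag_real Ah.
exists (U *m (Q *m S)), (map_mx (@complex.Re R) (spectral_diag A)).
split; [split|].
- rewrite !trmxC_mul Sh !mulmxA.
  rewrite -[_ *m S *m diag_mx _]mulmxA -[_ *m (_ *m _) *m S]mulmxA SWS mulmx1.
  by rewrite -[U *m Q *m _]mulmxA Qu mulmx1.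
- rewrite !trmxC_mul Sh !mulmxA.
  have -> : map_mx (real_complex R) (map_mx (@complex.Re R) (spectral_diag A))
      = spectral_diag A.
    by apply/matrixP=> i j; rewrite !mxE RRe_real//; apply: (mxOverP dr).
  have : U *m A *m U^t* = diag_mx (spectral_diag A).
    apply: etrans (congr1 (fun X => U *m X *m U^t* ) AE) _ => /=.
    by rewrite -invmx_unitary// !mulmxA mulmxV// mul1mx mulmxK.
  by rewrite /A !mulmxA.
- apply: eqmx_trans (_ : (Q *m S :=: V)%MS).
    by apply/eqmxMfull; rewrite row_full_unit.
  apply: eqmx_trans (eqmxMr _ QE) _.
  by rewrite -mulmxA TS mulmx1; apply: eq_row_base.
Qed.

(** * Quadratic forms in diagonalizing coordinates *)

Section Diagonalized.
Variables (R : rcfType) (k n : nat) (W H : 'M[R[i]]_n) (P : 'M[R[i]]_(k, n)).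
Variable d : 'rV[R]_k.
Hypothesis PD : diagonalizes W H P d.

(** Selecting rows rather than zeroing the others keeps the family independent, so [diagonalizes]
    passes to it and its rank is the number of chosen indices. *)
Definition spanrows (S : {pred 'I_k}) : 'M[R[i]]_(#|S|, n) :=
  rowsub (fun i : 'I_#|S| => enum_val i) P.

Lemma trmxC_rowsub m (g : 'I_m -> 'I_k) :
  (rowsub g P)^t* = colsub g (P^t*).
Proof. by apply/matrixP=> i j; rewrite !mxE. Qed.

Lemma diagonalizes_spanrows S :
  diagonalizes W H (spanrows S) (\row_i d 0 (enum_val i)).
Proof.
have [P1 PH] := PD; rewrite /spanrows.
split; rewrite trmxC_rowsub !mul_rowsub_mx mulmx_colsub ?P1 ?PH.
  by apply/matrixP=> i j; rewrite !mxE (inj_eq enum_val_inj).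
by apply/matrixP=> i j; rewrite !mxE (inj_eq enum_val_inj).
Qed.
End Diagonalized.

Section Forms.
Variables (R : rcfType) (k n : nat) (W H : 'M[R[i]]_n) (P : 'M[R[i]]_(k, n)).
Variable d : 'rV[R]_k.
Hypothesis PD : diagonalizes W H P d.

Lemma diagonalizes_free : row_free P.
Proof.
have [P1 _] := PD; rewrite /row_free eqn_leq rank_leq_row /=.
rewrite -{1}(mxrank1 R[i] k) -P1 -mulmxA; exact: mxrankM_maxl.
Qed.

Lemma diagonalizes_formW (a : 'rV[R[i]]_k) :
  ((a *m P) *m W *m (a *m P)^t*) 0 0 = \sum_i a 0 i * (a 0 i)^*.
Proof.
have [P1 _] := PD.
rewrite trmxC_mul !mulmxA -[a *m P *m W]mulmxA -[a *m _ *m P^t*]mulmxA P1 mulmx1.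
by rewrite mxE; apply: eq_bigr => i _; rewrite !mxE.
Qed.

Lemma diagonalizes_formH (a : 'rV[R[i]]_k) :
  ((a *m P) *m H *m (a *m P)^t*) 0 0 = \sum_i (d 0 i)%:C * (a 0 i * (a 0 i)^*).
Proof.
have [_ PH] := PD.
rewrite trmxC_mul !mulmxA -[a *m P *m H]mulmxA -[a *m _ *m P^t*]mulmxA PH.
rewrite mul_mx_diag mxE; apply: eq_bigr => i _; rewrite !mxE; ring.
Qed.

(** With x = aP the two forms are the sums of |a_i|^2 and of d_i |a_i|^2, which compare term by
    term. *)
Lemma form_le_diagonalizes mu (x : 'rV[R[i]]_n) :
  (forall i, d 0 i <= mu) -> (x <= P)%MS ->
  (x *m H *m x^t*) 0 0 <= mu%:C * (x *m W *m x^t*) 0 0.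
Proof.
move=> dmu /submxP[a ->]; rewrite diagonalizes_formH diagonalizes_formW.
rewrite mulr_sumr; apply: ler_sum => i _; apply: ler_wpM2r; last by rewrite lecR.
exact: mul_conjC_ge0.
Qed.

Lemma form_gt_diagonalizes mu (x : 'rV[R[i]]_n) :
  (forall i, mu < d 0 i) -> (x <= P)%MS -> x != 0 ->
  mu%:C * (x *m W *m x^t*) 0 0 < (x *m H *m x^t*) 0 0.
Proof.
move=> dmu /submxP[a ->] x0; rewrite diagonalizes_formH diagonalizes_formW.
have a0 : a != 0 by apply: contraNneq x0 => ->; rewrite mul0mx.
have /rV0Pn[j aj] := a0.
(* The index [j] with a_j nonzero supplies the strict inequality; the remaining terms are
   nonnegative. *)
rewrite mulr_sumr -subr_gt0 -sumrB (bigD1 j)//=.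
have g0 i : 0 <= a 0 i * (a 0 i)^* by exact: mul_conjC_ge0.
apply: ltr_pwDl.
  by rewrite -mulrBl mulr_gt0 ?mul_conjC_gt0// subr_gt0 ltcR.
by apply: sumr_ge0 => i _; rewrite -mulrBl mulr_ge0// subr_ge0 lecR ltW.
Qed.

End Forms.

Lemma rank_spanrows (R : rcfType) k n (W H : 'M[R[i]]_n) (P : 'M[R[i]]_(k, n)) d
    (S : {pred 'I_k}) : diagonalizes W H P d -> \rank (spanrows P S) = #|S|.
Proof. by move=> /diagonalizes_spanrows/(_ S)/diagonalizes_free/eqP. Qed.

Lemma spanrows_sub (R : rcfType) k n (P : 'M[R[i]]_(k, n)) (S : {pred 'I_k}) :
  (spanrows P S <= P)%MS.
Proof. by apply/row_subP => i; rewrite row_rowsub row_sub. Qed.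

Lemma rank_cap_ge (F : fieldType) m1 m2 m3 n (A : 'M[F]_(m1, n))
    (B : 'M[F]_(m2, n)) (V : 'M[F]_(m3, n)) :
  (A <= V)%MS -> (B <= V)%MS ->
  (\rank A + \rank B <= \rank V + \rank (A :&: B))%N.
Proof.
move=> AV BV; rewrite -mxrank_sum_cap leq_add2r; apply: mxrankS.
by rewrite addsmx_sub AV.
Qed.

(* If this failed, a dimension count would give x <> 0 in U with
   x H2 x* <= mu x W x* < x H1 x*. *)
Lemma count_le_diagonalizes (R : rcfType) n k1 k2 m (W H1 H2 : 'M[R[i]]_n)
    (P1 : 'M_(k1, n)) d1 (P2 : 'M_(k2, n)) d2 (U : 'M_(m, n)) r (mu : R) :
  diagonalizes W H1 P1 d1 -> diagonalizes W H2 P2 d2 ->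
  (U <= P1)%MS -> (U <= P2)%MS -> (k2 <= \rank U + r)%N ->
  (forall x : 'rV_n, (x <= U)%MS ->
     (x *m H1 *m x^t*) 0 0 <= (x *m H2 *m x^t*) 0 0) ->
  (#|[pred i | (d2 0 i <= mu)%R]| <= #|[pred i | (d1 0 i <= mu)%R]| + r)%N.
Proof.
move=> D1 D2 UP1 UP2 kU HU; rewrite leqNgt; apply/negP.
pose S2 : {pred 'I_k2} := [pred i | d2 0 i <= mu].
pose S1 : {pred 'I_k1} := [pred i | d1 0 i <= mu].
rewrite -/S1 -/S2 => lt.
have r1 : \rank P1 = k1 by apply/eqP; exact: diagonalizes_free D1.
have r2 : \rank P2 = k2 by apply/eqP; exact: diagonalizes_free D2.
have c1 : (#|S1| + #|predC S1| = k1)%N by rewrite cardC card_ord.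
have e1 := rank_spanrows (predC S1) D1.
have e2 := rank_spanrows S2 D2.
(* Inside [P2], the span for [S2] meets [U] in dimension at least |S2| - r; inside [P1], that
   intersection meets the span for the complement of [S1] in dimension at least |S2| - r - |S1|,
   which is positive. *)
have l2 := rank_cap_ge (spanrows_sub P2 S2) UP2.
have UP1' : (spanrows P2 S2 :&: U <= P1)%MS.
  exact: submx_trans (capmxSr _ _) UP1.
have l1 := rank_cap_ge UP1' (spanrows_sub P1 (predC S1)).
have : (spanrows P2 S2 :&: U :&: spanrows P1 (predC S1))%MS != 0.
  rewrite -mxrank_eq0 -lt0n.
  move: l1 l2 lt c1 kU; rewrite e1 e2 r1 r2.
  move: (\rank (_ :&: spanrows P1 _)%MS) => r12.
  move: (#|S1|) (#|S2|) (#|predC S1|) (\rank U) (\rank (_ :&: U)%MS).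
  lia.
move/rowV0Pn => [x]; rewrite !sub_capmx => /andP[/andP[x2 xU] x1] x0.
have le2 : (x *m H2 *m x^t*) 0 0 <= mu%:C * (x *m W *m x^t*) 0 0.
  apply: (form_le_diagonalizes (diagonalizes_spanrows D2 S2)) x2 => i.
  by rewrite mxE; exact: (enum_valP i).
have gt1 : mu%:C * (x *m W *m x^t*) 0 0 < (x *m H1 *m x^t*) 0 0.
  apply: (form_gt_diagonalizes (diagonalizes_spanrows D1 (predC S1))) x1 x0 => i.
  by rewrite mxE ltNge; exact: (enum_valP i).
have := lt_le_trans gt1 (le_trans (HU x xU) le2).
by rewrite ltxx.
Qed.

(** This is the weak eigenvalue equation on the row space of [P]. In coordinates it reads (d_i -
    lam) a_i = 0, so a is supported where d_i = lam. *)
Lemma sub_spanrows_eigen (R : rcfType) n k (W H : 'M[R[i]]_n) (P : 'M_(k, n)) d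
    (lam : R[i]) (x : 'rV_n) :
  diagonalizes W H P d ->
  (x <= spanrows P [pred i | (d 0 i)%:C == lam])%MS <->
  (x <= P)%MS /\ x *m (H - lam *: W) *m P^t* = 0.
Proof.
move=> [P1 PH]; pose S : {pred 'I_k} := [pred i | (d 0 i)%:C == lam]; rewrite -/S.
have key (a : 'rV_k) : a *m P *m (H - lam *: W) *m P^t* =
    \row_i (((d 0 i)%:C - lam) * a 0 i).
  rewrite -[a *m P *m _]mulmxA -[a *m _ *m _]mulmxA mulmxBr mulmxBl PH.
  rewrite -scalemxAr -scalemxAl P1 scalemx1 mulmxBr mul_mx_diag mul_mx_scalar.
  by apply/rowP=> i; rewrite !mxE; ring.
split=> [xS|[/submxP[a ->]]].
  split; first exact: submx_trans xS (spanrows_sub _ _).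
  have /submxP[b ->] := xS.
  have -> : spanrows P S = rowsub (fun i : 'I_#|S| => enum_val i) 1%:M *m P.
    by rewrite mul_rowsub_mx mul1mx.
  rewrite mulmxA key; apply/rowP=> i; rewrite !mxE.
  case: (eqVneq (d 0 i)%:C lam) => [->|ne]; first by rewrite subrr mul0r.
  rewrite big1 ?mulr0// => j _; rewrite !mxE.
  case: eqP => [ij|]; last by rewrite mulr0.
  by have := enum_valP j; rewrite ij unfold_in /= (negPf ne).
rewrite key => a0; rewrite mulmx_sum_row; apply: summx_sub => i _.
have [di|ndi] := boolP (i \in S); last first.
  have /rowP/(_ i) := a0; rewrite !mxE => /eqP; rewrite mulf_eq0 subr_eq0.
  by move: ndi; rewrite unfold_in /= => /negPf-> /eqP->; rewrite scale0r sub0mx.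
apply: scalemx_sub; have := row_sub (enum_rank_in di i) (spanrows P S).
by rewrite row_rowsub enum_rankK_in.
Qed.

(** Source of the Lagrange multipliers: a residual orthogonal to the constrained subspace is a
    combination of the constraint rows. One inclusion is immediate and the ranks agree. *)
Lemma orthogonal_kermx (C : numClosedFieldType) n m k (K : 'M[C]_(n, m))
    (P : 'M[C]_(k, n)) (g : 'rV[C]_n) :
  (P :=: kermx K)%MS -> (g *m P^t* = 0) <-> (g <= K^t*)%MS.
Proof.
move=> PK; have P0 : K^t* *m P^t* = 0.
  have : P *m K = 0 by apply/sub_kermxP; rewrite PK.
  by move/(congr1 (fun X => X^t* )); rewrite trmxC_mul trmx0 map_mx0.
have sub : (K^t* <= kermx (P^t*))%MS by apply/sub_kermxP.
have : (K^t* == kermx (P^t*))%MS.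
  rewrite -(mxrank_leqif_eq sub) mxrank_ker !mxrank_map !mxrank_tr PK mxrank_ker.
  by rewrite subKn// rank_leq_row.
move/eqmxP => E; rewrite E.
by split=> [|/sub_kermxP//]; move/sub_kermxP.
Qed.

(** * Eigenvalue lists and solution spaces *)

(** Take mu to be entry n + r of [s2]. At least n + r + 1 entries of [s2] are at most mu, hence at
    least n + 1 entries of [s1] are. *)
Lemma nth_le_of_count (R : realDomainType) (s1 s2 : seq R) r n :
  sorted <=%R s1 -> sorted <=%R s2 ->
  (forall mu, (count (<= mu) s2 <= count (<= mu) s1 + r)%N) ->
  (n + r < size s2)%N -> nth 0 s1 n <= nth 0 s2 (n + r).
Proof.
move=> o1 o2 cle lt; set mu := nth 0 s2 (n + r).
have c2 : (n + r < count (<= mu) s2)%N.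
  rewrite -(cat_take_drop (n + r).+1 s2) count_cat.
  have /eqP-> : count (<= mu) (take (n + r).+1 s2) == size (take (n + r).+1 s2).
    rewrite -all_count; apply/(all_nthP 0) => i; rewrite size_takel// => ilt.
    rewrite nth_take//; apply: (sorted_leq_nth le_trans le_refl) => //.
    by rewrite inE; apply: leq_ltn_trans lt.
  by rewrite size_takel// leq_addr.
have c1 := leq_trans c2 (cle mu); rewrite ltn_add2r in c1.
(* If entry n of [s1] exceeded mu, so would every later entry, leaving at most n entries below or
   equal to mu. *)
rewrite leNgt; apply/negP => gt1; move: c1; apply/negP; rewrite -leqNgt.
rewrite -(cat_take_drop n s1) count_cat.
have -> : count (<= mu) (drop n s1) = 0%N.
  apply/eqP; rewrite -leqn0 leqNgt -has_count; apply/negP.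
  case/(has_nthP 0) => i; rewrite size_drop nth_drop => ilt.
  apply/negP; rewrite -ltNge; apply: lt_le_trans gt1 _.
  apply: (sorted_leq_nth le_trans le_refl) => //; rewrite ?inE ?leq_addr //.
    by rewrite ltn_subRL in ilt; apply: leq_ltn_trans ilt; apply: leq_addr.
  by rewrite -ltn_subRL.
rewrite addn0; apply: leq_trans (count_size _ _) _.
by rewrite size_take; case: ltnP.
Qed.

(** Multiplicities determine the list up to order, so any given list may be exchanged for the one
    read off a diagonalization. *)
Lemma eig_list_perm (R : realType) N (f q w : nat -> R) AB s s' :
  eig_list N f q w AB s -> eig_list N f q w AB s' -> perm_eq s s'.
Proof.
move=> [_ c] [_ c']; apply/allP => x _ /=; apply/eqP.
have inj : injective (real_complex R) by exact: complexI.
by have := etrans (c x%:C) (esym (c' x%:C)); rewrite !count_map;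
  rewrite !(eq_count (fun y => inj_eq inj y x)).
Qed.

Lemma res_mapE (R : realType) N (f q w : nat -> R) AB lam y i :
  @res_map R N f q w AB lam y 0 i =
  if (i < N)%N then eq_res f q w lam y i.+1
  else (AB *m bvec f y) (inord (i - N)) 0.
Proof. by rewrite mxE. Qed.

(** [lin1_mx] only records values on basis vectors; linearity is what makes the kernel in
    [sol_space] the true set of solutions. *)
Lemma res_map_is_linear (R : realType) N (f q w : nat -> R) AB lam :
  linear (@res_map R N f q w AB lam).
Proof.
move=> a y y'.
have yvD k : yv (a *: y + y') k = a * yv y k + yv y' k by rewrite /yv !mxE.
have bD : bvec f (a *: y + y') = a *: bvec f y + bvec f y'.
  apply/colP => -[[|[|[|[|//]]]] ?]; rewrite !mxE /= /dlt ?yvD; ring.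
apply/rowP => i; rewrite [RHS]mxE [X in _ = X + _]mxE !res_mapE.
case: ifP => _; last first.
  by rewrite bD mulmxDr -scalemxAr [LHS]mxE [X in X + _ = _]mxE.
by rewrite /eq_res /dlt !yvD; ring.
Qed.

HB.instance Definition _ (R : realType) N (f q w : nat -> R) AB lam :=
  GRing.isLinear.Build R[i] 'rV[R[i]]_N.+2 'rV[R[i]]_N.+2 _
    (@res_map R N f q w AB lam) (res_map_is_linear f q w AB lam).

Lemma sol_spaceP (R : realType) N (f q w : nat -> R) AB lam (y : 'rV_N.+2) :
  (y <= sol_space N f q w AB lam)%MS <->
  (forall i, (i < N)%N -> @eq_res R N f q w lam y i.+1 = 0) /\ AB *m bvec f y = 0.
Proof.
rewrite /sol_space; split=> [/sub_kermxP|[ye yb]]; last first.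
  apply/sub_kermxP; rewrite mul_rV_lin1 /=; apply/rowP => i.
  rewrite res_mapE [RHS]mxE.
  by case: ifP => [/ye//|_]; rewrite yb mxE.
rewrite mul_rV_lin1 /= => /rowP y0; split=> [i iN|].
  have iN2 : (i < N.+2)%N by lia.
  by have := y0 (Ordinal iN2); rewrite res_mapE /= iN mxE.
apply/colP => j.
have jN2 : (N + j < N.+2)%N by have := ltn_ord j; lia.
have := y0 (Ordinal jN2); rewrite res_mapE /= ltnNge leq_addr /= addKn.
by rewrite inord_val => ->; rewrite !mxE.
Qed.

(** * The Hermitian form of the equation *)

Section Pencil.
Variables (R : realType) (M : nat) (f q w : nat -> R) (z : R[i]).
Local Notation C := R[i].
Local Notation n := M.+2.

Definition eL : 'rV[C]_n := delta_mx 0 ord0.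
Definition eR : 'rV[C]_n := delta_mx 0 ord_max.
Definition kap : 'cV[C]_n := eL^T + z^* *: eR^T.

Definition offdiag : 'M[C]_n := \matrix_(i, j) ((f j)%:C *+ (j == i.+1 :> nat)).

(* Coordinate i : 'I_n stands for y_(i+1). The terms f_0 and f_N are left out:
   they enter through the boundary fluxes f_0 (Delta y)_0 and f_N (Delta y)_N. *)
Definition jacobi : 'M[C]_n :=
  diag_mx (map_mx (real_complex R)
    (\row_i (q i.+1 + (if i == 0 :> nat then 0 else f i)
                    + (if i == M.+1 :> nat then 0 else f i.+1))))
  - offdiag - offdiag^T.

Definition weight : 'rV[R]_n := \row_i w i.+1.
Definition weightmx : 'M[C]_n := diag_mx (map_mx (real_complex R) weight).

Definition formmx (alpha beta : R) : 'M[C]_n :=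
  jacobi + alpha%:C *: (kap *m kap^t*) + beta%:C *: (eR^T *m eR).

(** An inactive constraint becomes a zero column, so all four combinations of [p] and [r] share one
    matrix size. *)
Definition constr (p r : bool) : 'M[C]_(n, 1 + 1) :=
  row_mx (p%:R *: kap) (r%:R *: eR^T).

Definition endval (x : 'rV[C]_n) : C := x 0 ord0 + z^* * x 0 ord_max.

Lemma kapC : kap^t* = eL + z *: eR.
Proof.
apply/matrixP=> i j; rewrite !mxE rmorphD rmorphM /=.
by rewrite !conjC_nat conjCK !ord1.
Qed.

Lemma mul_kap x : x *m kap = (endval x)%:M.
Proof.
rewrite /kap mulmxDr -scalemxAr /eL /eR !trmx_delta -!colE.
by apply/matrixP=> i j; rewrite !ord1 !mxE mulr1n.
Qed.

Lemma mul_eRT (x : 'rV_n) : x *m eR^T = (x 0 ord_max)%:M.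
Proof.
rewrite /eR !trmx_delta -!colE.
by apply/matrixP=> i j; rewrite !ord1 !mxE mulr1n.
Qed.

Lemma mul_formmx alpha beta x : x *m formmx alpha beta =
  x *m jacobi + (alpha%:C * endval x) *: (eL + z *: eR)
  + (beta%:C * x 0 ord_max) *: eR.
Proof.
rewrite /formmx !mulmxDr -!scalemxAr !mulmxA mul_kap mul_eRT !mul_scalar_mx kapC.
by rewrite !scalerA.
Qed.

Lemma jacobi_herm : jacobi^t* = jacobi.
Proof.
have offC : map_mx Num.conj offdiag = offdiag.
  apply/matrixP=> i j; rewrite !mxE; case: eqP => _; last by rewrite conjC0.
  by rewrite mulr1n; apply/CrealP/complex_realP; exists (f j).
rewrite /jacobi !linearB /= trmxK !map_mxB trmxC_real_diag.
by rewrite -!map_trmx offC addrAC.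
Qed.

Lemma formmx_herm alpha beta : (formmx alpha beta)^t* = formmx alpha beta.
Proof.
have rc (a : R) : Num.conj (a%:C : C) = a%:C.
  by apply/CrealP/complex_realP; exists a.
have eRC : eR^T^t* = eR.
  by apply/matrixP=> i j; rewrite !mxE conjC_nat.
have eRC' : eR^t* = eR^T.
  by apply/matrixP=> i j; rewrite !mxE conjC_nat.
have tD (A B : 'M[C]_n) : (A + B)^t* = A^t* + B^t* by rewrite linearD map_mxD.
have tZ (a : R) (A : 'M[C]_n) : (a%:C *: A)^t* = a%:C *: A^t*.
  by rewrite linearZ /= map_mxZ /= rc.
by rewrite /formmx 2!tD !tZ jacobi_herm !trmxC_mul trmxCK eRC eRC'.
Qed.

Lemma form_formmx alpha beta x :
  (x *m formmx alpha beta *m x^t*) 0 0 = (x *m jacobi *m x^t*) 0 0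
  + alpha%:C * (endval x * (endval x)^*)
  + beta%:C * (x 0 ord_max * (x 0 ord_max)^*).
Proof.
have e1 : (eL + z *: eR) *m x^t* = ((endval x)^*)%:M.
  rewrite -kapC -trmxC_mul mul_kap; apply/matrixP=> i j; rewrite !ord1 !mxE eqxx.
  by rewrite !mulr1n.
have e2 : eR *m x^t* = ((x 0 ord_max)^*)%:M.
  rewrite /eR -rowE; apply/matrixP=> i j; rewrite !ord1 !mxE.
  by rewrite !mulr1n.
rewrite mul_formmx !mulmxDl -!scalemxAl e1 e2 !scale_scalar_mx.
rewrite [LHS]mxE [X in X + _ = _]mxE ![(_%:M) _ _]mxE !eqxx !mulr1n.
by rewrite !mulrA.
Qed.

Lemma sub_ker_constr p r (x : 'rV_n) :
  (x <= kermx (constr p r))%MS <->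
  (p -> endval x = 0) /\ (r -> x 0 ord_max = 0).
Proof.
have E : x *m constr p r =
    row_mx (p%:R *: (endval x)%:M) (r%:R *: (x 0 ord_max)%:M).
  by rewrite /constr mul_mx_row -!scalemxAr mul_kap mul_eRT.
split=> [/sub_kermxP|[hp hr]].
  rewrite E -row_mx0 => /eq_row_mx[/matrixP/(_ 0 0) + /matrixP/(_ 0 0)].
  by rewrite !mxE !eqxx !mulr1n; case: p E; case: r; rewrite ?mul1r => //.
apply/sub_kermxP; rewrite E -row_mx0; congr row_mx.
  by case: p hp {E} => [->//|_]; rewrite ?scale0r ?scalar_mx0 ?scaler0 ?raddf0.
by case: r hr {E} => [->//|_]; rewrite ?scale0r ?scalar_mx0 ?scaler0 ?raddf0.
Qed.

Lemma constr_trmxC p r : (constr p r)^t* =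
  col_mx (p%:R *: (eL + z *: eR)) (r%:R *: eR).
Proof.
rewrite /constr tr_row_mx map_col_mx !linearZ /= !map_mxZ /= !conjC_nat.
rewrite kapC trmxK.
by congr col_mx; congr (_ *: _); apply/matrixP=> i j; rewrite !mxE conjC_nat.
Qed.

Lemma sub_constr p r (g : 'rV[C]_n) : (g <= (constr p r)^t*)%MS <->
  exists t1 t2 : C, g = (t1 * p%:R) *: (eL + z *: eR) + (t2 * r%:R) *: eR.
Proof.
rewrite constr_trmxC; split=> [/submxP[t ->]|[t1 [t2 ->]]].
  exists (lsubmx t 0 0), (rsubmx t 0 0).
  rewrite -[t in LHS]hsubmxK mul_row_col.
  rewrite [lsubmx t in LHS]mx11_scalar [rsubmx t in LHS]mx11_scalar.
  by rewrite !mul_scalar_mx !scalerA.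
apply/submxP; exists (row_mx t1%:M t2%:M).
by rewrite mul_row_col !mul_scalar_mx !scalerA.
Qed.

Lemma rank_ker_constr (p r : bool) : \rank (kermx (constr p r)) = (n - (p + r))%N.
Proof.
rewrite mxrank_ker; congr subn.
have -> : constr p r = row_mx kap eR^T *m (block_mx p%:R%:M 0 0 r%:R%:M).
  by rewrite mul_row_block !mulmx0 addr0 add0r !mul_mx_scalar.
have full : row_full (row_mx kap eR^T).
  (* This left inverse consists of the rows dual to the columns [kap] and [eR^T]; it relies on the
     first and last coordinates being distinct. *)
  apply/row_fullP; exists (col_mx eL (eR - z^* *: eL)).
  rewrite mul_col_row scalar_mx_block !mul_kap !mul_eRT /endval !mxE !eqxx /=.
  by rewrite !(mulr0, mulr1, addr0, subr0, sub0r, add0r, addNr, raddf0).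
rewrite (eqmxMfull _ full) rank_diag_block_mx.
by case: p r => [] []; rewrite ?(raddf0, mxrank0, mxrank1).
Qed.

Lemma mul_offdiag (x : 'rV[C]_n) (i : 'I_n) :
  (x *m offdiag) 0 i = if i == 0 :> nat then 0 else (f i)%:C * x 0 (inord i.-1).
Proof.
rewrite mxE; case: eqP => i0.
  by apply: big1 => j _; rewrite mxE i0 mulr0.
have lti : (i.-1 < n)%N by have := ltn_ord i; lia.
rewrite (bigD1 (inord i.-1)) //= big1 ?addr0.
  by rewrite mxE inordK// prednK ?lt0n ?eqxx 1?mulrC//; apply/eqP.
move=> j ne; rewrite mxE; case: eqP => [ij|]; last by rewrite mulr0.
by case/eqP: ne; apply: val_inj; rewrite /= inordK// ij.
Qed.

Lemma mul_offdiagT (x : 'rV[C]_n) (i : 'I_n) :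
  (x *m offdiag^T) 0 i =
  if i == M.+1 :> nat then 0 else (f i.+1)%:C * x 0 (inord i.+1).
Proof.
rewrite mxE; case: eqP => i0.
  apply: big1 => j _; rewrite !mxE i0; case: eqP => [jM|]; last by rewrite mulr0.
  by have := ltn_ord j; rewrite jM ltnn.
have lti : (i.+1 < n)%N by have := ltn_ord i; lia.
rewrite (bigD1 (inord i.+1)) //= big1 ?addr0.
  by rewrite !mxE inordK// eqxx mulrC.
move=> j ne; rewrite !mxE; case: eqP => [ij|]; last by rewrite mulr0.
by case/eqP: ne; apply: val_inj; rewrite /= inordK// ij.
Qed.

Definition interior (y : 'rV[C]_n.+2) : 'rV[C]_n := \row_i yv y i.+1.

(** The values y_0 and y_(N+1) occur only in the first and last equations, and there only through
    the two fluxes; what remains is tridiagonal in the interior values. *)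
Lemma eq_res_jacobi lam (y : 'rV[C]_n.+2) (i : 'I_n) :
  eq_res f q w lam y i.+1 = (interior y *m (jacobi - lam *: weightmx)
    + ((f 0)%:C * dlt y 0) *: eL - ((f n)%:C * dlt y n) *: eR) 0 i.
Proof.
pose x := interior y.
have -> : (x *m (jacobi - lam *: weightmx)
    + ((f 0)%:C * dlt y 0) *: eL - ((f n)%:C * dlt y n) *: eR) 0 i =
    (q i.+1 + (if i == 0 :> nat then 0 else f i)
      + (if i == M.+1 :> nat then 0 else f i.+1))%:C * x 0 i
    - (x *m offdiag) 0 i - (x *m offdiag^T) 0 i - lam * (w i.+1)%:C * x 0 i
    + ((f 0)%:C * dlt y 0) *+ (i == 0 :> nat)
    - ((f n)%:C * dlt y n) *+ (i == M.+1 :> nat).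
  rewrite /jacobi !mulmxBr -scalemxAr !mul_mx_diag.
  move: (x *m offdiag) (x *m offdiag^T) => A B.
  rewrite !mxE -!val_eqE /= !mulr_natr; ring.
rewrite mul_offdiag mul_offdiagT /x /eq_res /dlt /=.
have lti := ltn_ord i.
case: (eqVneq (i : nat) 0%N) => [i0|i0].
  case: (eqVneq (i : nat) M.+1) => [|_]; first by rewrite i0.
  rewrite !mxE i0 !inordK // !rmorphD /= mulr1n mulr0n; ring.
case: (eqVneq (i : nat) M.+1) => [iM|iM].
  have -> : i.+1 = n by rewrite iM.
  rewrite !mxE !inordK; try lia.
  rewrite prednK ?lt0n // iM !rmorphD /= mulr1n mulr0n; ring.
rewrite !mxE !inordK; try lia.
rewrite prednK ?lt0n // !rmorphD /= !mulr0n; ring.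
Qed.

End Pencil.

(** * Multiplicity as the number of equal diagonal entries *)

Section Multiplicity.
Variables (R : realType) (M : nat) (f q w : nat -> R) (z : R[i]).
Local Notation C := R[i].
Local Notation n := M.+2.
Local Notation eL := (eL R M).
Local Notation eR := (eR R M).
Local Notation jacobi := (jacobi M f q).
Local Notation weightmx := (weightmx M w).

(** Here [x1] and [xN] are y_1 and y_N, while [u] and [v] are the fluxes f_0 (Delta y)_0 and f_N
    (Delta y)_N. An active constraint leaves its flux free, as a Lagrange multiplier. *)
Definition bc_rel alpha (p : bool) beta (r : bool) (x1 xN u v : C) : Prop :=
  (if p then x1 + z^* * xN = 0 else u = alpha%:C * (x1 + z^* * xN)) /\
  (if r then xN = 0 else v = - z * u - beta%:C * xN).

(* y0 + u / f_0 is y_1, since u stands for f_0 (y_1 - y_0). *)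
Definition realizes (AB : 'M[C]_(2, 4)) alpha p beta r : Prop :=
  forall y0 u yN v : C,
    AB *m (\col_(j < 4) nth 0 [:: y0; u; yN; v] j) = 0 <->
    bc_rel alpha p beta r (y0 + (f 0)^-1%:C * u) yN u v.

(** Stationarity on the constrained subspace puts the residual of the form in the span of the active
    constraint rows. Collecting the coefficients of [eL] and [eR] turns the multipliers into fluxes
    obeying the boundary condition, and conversely. *)
Lemma sub_spanrows_bc_rel alpha p beta r k (P : 'M[C]_(k, n)) d lam (x : 'rV_n) :
  diagonalizes weightmx (formmx M f q z alpha beta) P d ->
  (P :=: kermx (constr M z p r))%MS ->
  (x <= spanrows P [pred i | (d 0 i)%:C == lam])%MS <->
  exists u v, x *m (jacobi - lam *: weightmx) + u *: eL - v *: eR = 0 /\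
    bc_rel alpha p beta r (x 0 ord0) (x 0 ord_max) u v.
Proof.
move=> D PK.
apply: iff_trans (sub_spanrows_eigen lam x D) _.
rewrite PK.
apply: iff_trans (and_iff_compat_l _ (orthogonal_kermx _ PK)) _.
apply: iff_trans (and_iff_compat_l _ (sub_constr _ _ _ _)) _.
apply: iff_trans (and_iff_compat_r _ (sub_ker_constr _ _ _ _)) _.
rewrite (mulmxBr _ (formmx _ _ _ _ _ _)) (mulmxBr _ jacobi) mul_formmx.
move: (x *m jacobi) (x *m (lam *: weightmx)) => A B {D PK}.
rewrite /bc_rel -/(endval z x).
set e := endval z x; set xN := x 0 ord_max.
split=> [[[hp hr] [t1 [t2 gE]]]|[u [v [gE [hp hr]]]]].
  exists (alpha%:C * e - t1 * p%:R).
  exists (- (z * (alpha%:C * e - t1 * p%:R) + beta%:C * xN - t2 * r%:R)).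
  split.
    apply/rowP=> i; have /rowP/(_ i) := gE; rewrite !mxE => /eqP.
    by rewrite -subr_eq0 => /eqP E; rewrite -[RHS]E; ring.
  split; first by case: p hp {gE} => hp; [exact: hp | rewrite /= mulr0n; ring].
  by case: r hr {gE} => hr; [exact: hr | rewrite /= mulr0n; ring].
split; first by split; [case: (p) hp | case: (r) hr].
(* Each multiplier is the defect of the corresponding flux relation, so it vanishes when its
   constraint is inactive ([E1], [E2]). *)
exists (alpha%:C * e - u), (z * u + v + beta%:C * xN).
apply/rowP=> i; have /rowP/(_ i) := gE; rewrite !mxE => {}gE.
have E1 : (alpha%:C * e - u) * p%:R = alpha%:C * e - u.
  by case: p hp => hp; rewrite ?mulr1 // hp subrr mul0r.
have E2 : (z * u + v + beta%:C * xN) * r%:R = z * u + v + beta%:C * xN.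
  by case: r hr => hr; rewrite ?mulr1 // hr; ring.
rewrite E1 E2 -[LHS]subr0 -gE; ring.
Qed.

Hypotheses (f0 : f 0 != 0) (fn : f n != 0).

Lemma sol_space_interior AB alpha p beta r lam (y : 'rV[C]_n.+2) :
  realizes AB alpha p beta r ->
  (y <= sol_space n f q w AB lam)%MS <->
  let u := (f 0)%:C * dlt y 0 in let v := (f n)%:C * dlt y n in
  let x := interior y in
  x *m (jacobi - lam *: weightmx) + u *: eL - v *: eR = 0 /\
  bc_rel alpha p beta r (x 0 ord0) (x 0 ord_max) u v.
Proof.
move=> AB_bc; apply: iff_trans (sol_spaceP _ _ _ _ _ _) _; cbv zeta.
have -> : bvec f y = \col_(j < 4) nth 0 [:: yv y 0; (f 0)%:C * dlt y 0;
  yv y n; (f n)%:C * dlt y n] j by [].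
apply: iff_trans (and_iff_compat_l _ (AB_bc _ _ _ _)) _.
have -> : yv y 0 + (f 0)^-1%:C * ((f 0)%:C * dlt y 0) = interior y 0 ord0.
  by rewrite mulrA -rmorphM mulVf// mul1r mxE /dlt addrC subrK.
have -> : yv y n = interior y 0 ord_max by rewrite mxE.
apply: and_iff_compat_r; split=> [h|h i iN].
  by apply/rowP=> i; rewrite -eq_res_jacobi h ?mxE.
by rewrite (eq_res_jacobi _ _ _ _ _ (Ordinal iN)) h mxE.
Qed.

Definition interiormx : 'M[C]_(n.+2, n) :=
  colsub (fun i : 'I_n => inord i.+1) 1%:M.

Lemma mul_interiormx y : y *m interiormx = interior y.
Proof. by rewrite mulmx_colsub mulmx1; apply/rowP=> i; rewrite !mxE. Qed.

(** Restriction to the interior is injective on solutions: zero interior values force zero fluxes,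
    and f_0 and f_N are nonzero. Its image is the span of the rows with d_i = lam. *)
Lemma mult_eq_card AB alpha p beta r k (P : 'M[C]_(k, n)) d lam :
  realizes AB alpha p beta r ->
  diagonalizes weightmx (formmx M f q z alpha beta) P d ->
  (P :=: kermx (constr M z p r))%MS ->
  mult n f q w AB lam = #|[pred i | (d 0 i)%:C == lam]|.
Proof.
move=> AB_bc D PK; rewrite /mult -(rank_spanrows _ D).
have f0C : (f 0)%:C != 0 :> C by rewrite fmorph_eq0.
have fnC : (f n)%:C != 0 :> C by rewrite fmorph_eq0.
rewrite -(mxrank_mul_ker _ interiormx).
have -> : (sol_space n f q w AB lam :&: kermx interiormx)%MS = 0.
  apply/eqP/rowV0P => y; rewrite sub_capmx => /andP[ys /sub_kermxP].
  rewrite mul_interiormx => y0.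
  have /(sol_space_interior _ _ AB_bc)[] := ys; rewrite y0 mul0mx add0r => uv _.
  have inner j : (0 < j <= n)%N -> yv y j = 0.
    move=> kn; have kn' : (j.-1 < n)%N by lia.
    by have /rowP/(_ (Ordinal kn')) := y0; rewrite !mxE /= prednK//; lia.
  have /rowP/(_ ord0) := uv; rewrite !mxE /= mulr1 mulr0 subr0 => /eqP.
  rewrite mulf_eq0 (negPf f0C) /= /dlt inner// sub0r oppr_eq0 => /eqP yv0.
  have /rowP/(_ ord_max) := uv; rewrite !mxE /= eqxx mulr1 mulr0 sub0r => /eqP.
  rewrite oppr_eq0 mulf_eq0 (negPf fnC) /= /dlt (inner n) ?leqnn// subr0.
  move=> /eqP yvn.
  apply/rowP=> i; rewrite mxE -(inord_val i).
  have [i0|i0] := eqVneq (i : nat) 0%N; first by rewrite i0.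
  have [i1|i1] := eqVneq (i : nat) n.+1; first by rewrite i1.
  by apply: inner; have := ltn_ord i; lia.
rewrite mxrank0 addn0; apply/eqmx_rank/andP; split; apply/rV_subP => x.
  move=> /submxP[a ->]; rewrite mulmxA mul_interiormx.
  have /(sol_space_interior _ _ AB_bc)[h1 h2] :=
    submxMl a (sol_space n f q w AB lam).
  apply/(sub_spanrows_bc_rel _ _ D PK).
  by exists ((f 0)%:C * dlt (a *m sol_space n f q w AB lam) 0),
            ((f n)%:C * dlt (a *m sol_space n f q w AB lam) n).
move/(sub_spanrows_bc_rel _ _ D PK) => [u [v [h1 h2]]].
(* The endpoint values are solved from u = f_0 (y_1 - y_0) and v = f_N (y_(N+1) - y_N). *)
pose y : 'rV[C]_n.+2 := \row_k
  (if k == 0 :> nat then x 0 ord0 - (f 0)^-1%:C * u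
   else if k == n.+1 :> nat then x 0 ord_max + (f n)^-1%:C * v
   else x 0 (inord k.-1)).
have yx : interior y = x.
  apply/rowP=> i; rewrite mxE /yv mxE; have lti := ltn_ord i.
  rewrite inordK; last by lia.
  by rewrite /= ifF ?inord_val //; lia.
have y0 : yv y 0 = x 0 ord0 - (f 0)^-1%:C * u by rewrite /yv mxE inordK.
have yn1 : yv y n.+1 = x 0 ord_max + (f n)^-1%:C * v.
  by rewrite /yv mxE inordK //= eqxx.
have y1 : yv y 1 = x 0 ord0 by rewrite -yx mxE.
have yn : yv y n = x 0 ord_max by rewrite -yx mxE.
have uE : (f 0)%:C * dlt y 0 = u.
  by rewrite /dlt y0 y1 opprB addrC subrK mulrA -rmorphM mulfV// mul1r.
have vE : (f n)%:C * dlt y n = v.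
  by rewrite /dlt yn1 yn addrC addKr mulrA -rmorphM mulfV// mul1r.
rewrite -yx -mul_interiormx; apply: submxMr.
by apply/(sol_space_interior _ _ AB_bc); rewrite /= yx uE vE.
Qed.

End Multiplicity.

(** * The three boundary conditions *)

Lemma col2_eq0 (T : nmodType) (A : 'cV[T]_2) :
  A = 0 <-> A ord0 0 = 0 /\ A ord_max 0 = 0.
Proof.
split=> [->|[A0 A1]]; first by rewrite !mxE.
apply/colP => -[[|[|//]] lt]; rewrite mxE; [rewrite -A0|rewrite -A1];
  by congr (A _ _); apply: val_inj.
Qed.

(* When c = 1 / f 0 - a vanishes, alpha is 0^-1 = 0 and plays no role. *)
Lemma bcA_realizes (R : realType) (f : nat -> R) (z : R[i]) a b :
  realizes f z (bcA z a b) (1 / f 0 - a)^-1 (a == 1 / f 0) b false.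
Proof.
move=> y0 u yN v; rewrite /bc_rel.
apply: iff_trans (col2_eq0 _) _.
rewrite !mxE !big_ord_recl !big_ord0 !mxE /= mul1r !mul0r !addr0 add0r.
set e := y0 + _ + _.
have eE : y0 + (a%:C * u + z^* * yN) = e - (1 / f 0 - a)%:C * u.
  by rewrite /e div1r rmorphB /=; ring.
rewrite eE; split=> [[h1 h2]|[h1 h2]]; split.
- case: eqP h1 => [->|/eqP ne]; first by rewrite subrr mul0r subr0.
  move/eqP; rewrite subr_eq0 => /eqP ->; rewrite mulrA -rmorphM mulVf ?mul1r//.
  by rewrite -div1r subr_eq0 eq_sym.
- by apply/eqP; rewrite -subr_eq0 -h2; apply/eqP; ring.
- case: eqP h1 => [->|/eqP ne] h1; first by rewrite h1 subrr mul0r subr0.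
  rewrite h1 mulrA -rmorphM mulfV ?mul1r ?subrr//.
  by rewrite -div1r subr_eq0 eq_sym.
- by rewrite h2; ring.
Qed.

Lemma bcS1_realizes (R : realType) (f : nat -> R) (z : R[i]) b :
  realizes f z (bcS1 b) 0 false b false.
Proof.
move=> y0 u yN v; rewrite /bc_rel.
apply: iff_trans (col2_eq0 _) _.
rewrite !mxE !big_ord_recl !big_ord0 !mxE /= !mul0r !mul1r !addr0 !add0r.
split=> [[-> h]|[-> ->]]; split=> //; last by ring.
by apply/eqP; rewrite -subr_eq0 -[X in _ == X]h; apply/eqP; ring.
Qed.

Lemma bcS2_realizes (R : realType) (f : nat -> R) (z : R[i]) a :
  realizes f z (bcS2 a) (1 / f 0 - a)^-1 (a == 1 / f 0) 0 true.
Proof.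
move=> y0 u yN v; rewrite /bc_rel.
apply: iff_trans (col2_eq0 _) _.
rewrite !mxE !big_ord_recl !big_ord0 !mxE /= !mul0r !addr0 !add0r.
rewrite (mul1r y0) (mul1r yN).
set e := y0 + _ + _.
have eE : yN = 0 -> y0 + a%:C * u = e - (1 / f 0 - a)%:C * u.
  by move=> yN0; rewrite /e yN0 div1r rmorphB /=; ring.
split=> -[h1 yN0]; split=> //.
- move: h1; rewrite eE//; case: eqP => [->|/eqP ne].
    by rewrite subrr mul0r subr0.
  move/eqP; rewrite subr_eq0 => /eqP ->; rewrite mulrA -rmorphM mulVf ?mul1r//.
  by rewrite -div1r subr_eq0 eq_sym.
- rewrite eE//; case: eqP h1 => [->|/eqP ne] h1.
    by rewrite h1 subrr mul0r subr0.
  rewrite h1 mulrA -rmorphM mulfV ?mul1r ?subrr//.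
  by rewrite -div1r subr_eq0 eq_sym.
Qed.

Lemma count_map_enum (I : finType) (T : Type) (g : I -> T) (a : pred T) :
  count a [seq g i | i <- enum I] = #|[pred i | a (g i)]|.
Proof. by rewrite count_map -sum1_count -sum1_card big_enum_cond. Qed.

Lemma codim_le a b c d n :
  (n - (b + d) <= n - (a + c) + ((a - b) + (c - d)))%N.
Proof. lia. Qed.

(** Makes an index legal for either eigenvalue count, whether or not a_12 equals 1 / f_0. *)
Lemma ltn_subb j n (b : bool) : (j < n)%N -> (j < n.+1 - b)%N.
Proof. by case: b => jn; rewrite ?subn1 ?subn0 // ltnW. Qed.

(** * Eigenvalue counts and comparison of eigenvalue lists *)

Section Comparison.
Variables (R : realType) (M : nat) (f q w : nat -> R) (z : R[i]).
Local Notation n := M.+2.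
Hypothesis f_neq0 : forall k, (k <= n)%N -> f k != 0.
Hypothesis w_gt0 : forall k, (1 <= k <= n)%N -> 0 < w k.

Lemma exists_eig_list AB alpha p beta r :
  realizes f z AB alpha p beta r ->
  exists k (P : 'M[R[i]]_(k, n)) d,
    [/\ k = (n - (p + r))%N,
        diagonalizes (weightmx M w) (formmx M f q z alpha beta) P d,
        (P :=: kermx (constr M z p r))%MS &
        eig_list n f q w AB (sort <=%R [seq d 0 i | i <- enum 'I_k])].
Proof.
move=> AB_bc.
have w0 i : 0 < weight M w 0 i by rewrite mxE w_gt0 //= ltn_ord.
have [P [d [D PK]]] := exists_diagonalizes (kermx (constr M z p r)) w0
  (formmx_herm M f q z alpha beta).
exists (\rank (kermx (constr M z p r))), P, d; split=> //.
  exact: rank_ker_constr.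
split; first exact: sort_le_sorted.
move=> lam.
rewrite (mult_eq_card (f_neq0 _) (f_neq0 _) _ AB_bc D PK)// count_map count_sort.
by rewrite count_map_enum.
Qed.

Lemma has_exactly_realizes AB alpha p beta r :
  realizes f z AB alpha p beta r -> has_exactly n f q w AB (n - (p + r)).
Proof.
move=> /exists_eig_list[k [P [d [kE _ _ L]]]].
by eexists; split; first exact: L; rewrite size_sort size_map size_enum_ord.
Qed.

(* The larger form is on the right; (p, r) describe a subspace of both domains
   on which the forms are ordered. *)
Lemma eig_list_le (p r : bool) AB1 AB2 alpha1 alpha2 p1 p2 beta1 beta2 r1 r2
    s1 s2 m j :
  realizes f z AB1 alpha1 p1 beta1 r1 -> realizes f z AB2 alpha2 p2 beta2 r2 ->
  eig_list n f q w AB1 s1 -> eig_list n f q w AB2 s2 ->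
  p1 || p2 ==> p -> r1 || r2 ==> r ->
  (~~ p -> alpha1 <= alpha2) -> (~~ r -> beta1 <= beta2) ->
  j = (m + ((p - p2) + (r - r2)))%N -> (j < n - (p2 + r2))%N ->
  nth 0 s1 m <= nth 0 s2 j.
Proof.
move=> bc1 bc2 L1 L2 pp rr le_a le_b ->.
have [k1 [P1 [d1 [kE1 D1 PK1 L1']]]] := exists_eig_list bc1.
have [k2 [P2 [d2 [kE2 D2 PK2 L2']]]] := exists_eig_list bc2.
have pm1 := eig_list_perm L1 L1'; have pm2 := eig_list_perm L2 L2'.
have sz2 : size s2 = (n - (p2 + r2))%N.
  by rewrite (perm_size pm2) size_sort size_map size_enum_ord.
rewrite -sz2; apply: nth_le_of_count; [by case: L1 | by case: L2 | move=> mu].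
have cE k (d : 'rV[R]_k) :
    count (<= mu) (sort <=%R [seq d 0 i | i <- enum 'I_k]) =
    #|[pred i | d 0 i <= mu]|.
  by rewrite count_sort count_map_enum; apply: eq_card => i; rewrite !inE.
rewrite (permP pm1) (permP pm2) !cE.
apply: (count_le_diagonalizes (U := kermx (constr M z p r)) mu D1 D2).
- rewrite PK1; apply/rV_subP => x /sub_ker_constr[hp hr]; apply/sub_ker_constr.
  by split=> h; [apply: hp; move: pp | apply: hr; move: rr]; rewrite h.
- rewrite PK2; apply/rV_subP => x /sub_ker_constr[hp hr]; apply/sub_ker_constr.
  by split=> h; [apply: hp; move: pp | apply: hr; move: rr]; rewrite h orbT.
- by rewrite rank_ker_constr kE2; exact: codim_le.
- move=> x /sub_ker_constr[hp hr].
  rewrite [leLHS](form_formmx f q z alpha1 beta1 x).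
  rewrite [leRHS](form_formmx f q z alpha2 beta2 x).
  rewrite -!addrA.
  rewrite lerD2l.
  apply: lerD.
    (* If [p] holds, [endval x] vanishes and both alpha terms are zero; otherwise the alphas are
       ordered. The beta terms behave alike with [r]. *)
    case: p hp le_a {pp} => [->//|_ le_a]; first by rewrite mul0r !mulr0.
    by apply: ler_wpM2r; [exact: mul_conjC_ge0 | rewrite lecR le_a].
  case: r hr le_b {rr} => [->//|_ le_b]; first by rewrite mul0r !mulr0.
  by apply: ler_wpM2r; [exact: mul_conjC_ge0 | rewrite lecR le_b].
Qed.

End Comparison.

Theorem theorem3p2 (R : realType) (N : nat) (f q w : nat -> R) (z : R[i]) :
  (2 <= N)%N ->
  (forall n, (n <= N)%N -> f n != 0) ->
  (forall n, (1 <= n <= N)%N -> 0 < w n) ->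
  (* eigenvalue counts *)
  (forall a12 b21 : R,
     has_exactly N f q w (bcA z a12 b21)
       (if a12 == 1 / f 0 then N.-1 else N)) /\
  (forall b21 : R, has_exactly N f q w (bcS1 b21) N) /\
  (forall a12 : R,
     has_exactly N f q w (bcS2 a12)
       (if a12 == 1 / f 0 then N.-2 else N.-1)) /\
  (* (i) *)
  (forall (b21 a1 a2 a3 a4 : R) (s1 s2 s3 s4 sS : seq R),
     a1 < a2 -> a2 <= 1 / f 0 -> 1 / f 0 < a3 -> a3 < a4 ->
     eig_list N f q w (bcA z a1 b21) s1 ->
     eig_list N f q w (bcA z a2 b21) s2 ->
     eig_list N f q w (bcA z a3 b21) s3 ->
     eig_list N f q w (bcA z a4 b21) s4 ->
     eig_list N f q w (bcS1 b21) sS ->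
     (forall n, (n.+2 <= N)%N ->
        nth 0 s3 n <= nth 0 s4 n /\ nth 0 s4 n <= nth 0 sS n /\
        nth 0 sS n <= nth 0 s1 n /\ nth 0 s1 n <= nth 0 s2 n /\
        nth 0 s2 n <= nth 0 s3 n.+1) /\
     (nth 0 s3 N.-1 <= nth 0 s4 N.-1 /\ nth 0 s4 N.-1 <= nth 0 sS N.-1 /\
      nth 0 sS N.-1 <= nth 0 s1 N.-1) /\
     (a2 < 1 / f 0 -> nth 0 s1 N.-1 <= nth 0 s2 N.-1)) /\
  (* (ii) *)
  (forall (a12 b1 b2 : R) (s1 s2 sS : seq R),
     b1 < b2 ->
     eig_list N f q w (bcA z a12 b1) s1 ->
     eig_list N f q w (bcA z a12 b2) s2 ->
     eig_list N f q w (bcS2 a12) sS ->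
     (forall n, (n.+3 <= N)%N ->
        nth 0 s1 n <= nth 0 s2 n /\ nth 0 s2 n <= nth 0 sS n /\
        nth 0 sS n <= nth 0 s1 n.+1) /\
     nth 0 s1 (N.-2) <= nth 0 s2 (N.-2) /\
     (a12 != 1 / f 0 ->
        nth 0 s2 (N.-2) <= nth 0 sS (N.-2) /\
        nth 0 sS (N.-2) <= nth 0 s1 N.-1 /\
        nth 0 s1 N.-1 <= nth 0 s2 N.-1)).
Proof.
case: N => [//|[//|M]] _ f0 w0.
have LE p r := @eig_list_le R M f q w z f0 w0 p r.
have EX := @has_exactly_realizes R M f q w z f0 w0.
split; [|split; [|split; [|split]]].
- move=> a b; have := EX _ _ _ _ _ (bcA_realizes f z a b).
  by case: (a == _); rewrite ?addn0 ?subn1 ?subn0.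
- by move=> b; have := EX _ _ _ _ _ (bcS1_realizes f z b); rewrite subn0.
- move=> a; have := EX _ _ _ _ _ (bcS2_realizes f z a).
  by case: (a == _); rewrite ?subn2 ?subn1.
- move=> b a1 a2 a3 a4 s1 s2 s3 s4 sS a12 a2f fa3 a34 L1 L2 L3 L4 LS.
  have B a := bcA_realizes f z a b; have BS := bcS1_realizes f z b.
  have n1 : (a1 == 1 / f 0) = false by apply/lt_eqF/(lt_le_trans a12).
  have n3 : (a3 == 1 / f 0) = false by apply/gt_eqF.
  have n4 : (a4 == 1 / f 0) = false by apply/gt_eqF/(lt_trans fa3).
  (* The map from a to 1 / (1 / f_0 - a) increases on each side of its pole, positive to the left
     and negative to the right. This gives alpha3 <= alpha4 < 0 < alpha1, with 0 the value for S1,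
     and alpha1 <= alpha2 when a2 is not the pole. *)
  have i1 : 0 < (1 / f 0 - a1)^-1.
    by rewrite invr_gt0 subr_gt0; apply: lt_le_trans a2f.
  have i4 : (1 / f 0 - a4)^-1 < 0.
    by rewrite invr_lt0 subr_lt0; apply: lt_trans a34.
  have i34 : (1 / f 0 - a3)^-1 <= (1 / f 0 - a4)^-1.
    rewrite lef_nV2 ?posrE ?negrE ?subr_lt0 //; last exact: lt_trans a34.
    by rewrite lerD2l lerN2 ltW.
  have i12 : a2 != 1 / f 0 -> (1 / f 0 - a1)^-1 <= (1 / f 0 - a2)^-1.
    move=> ne; have lt2 : a2 < 1 / f 0 by rewrite lt_neqAle ne.
    rewrite lef_pV2 ?posrE ?subr_gt0 //; last exact: lt_trans lt2.
    by rewrite lerD2l lerN2 ltW.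
  have B1 := B a1; have B2 := B a2; have B3 := B a3; have B4 := B a4.
  rewrite n1 in B1; rewrite n3 in B3; rewrite n4 in B4.
  have c34 j : (j < M.+2)%N -> nth 0 s3 j <= nth 0 s4 j.
    by move=> jN; apply: (LE false false) B3 B4 _ _ _ _ _ _ _ _ => //;
      rewrite ?addn0.
  have c4S j : (j < M.+2)%N -> nth 0 s4 j <= nth 0 sS j.
    move=> jN; apply: (LE false false) B4 BS _ _ _ _ _ _ _ _ => //;
      rewrite ?addn0//.
    by rewrite ltW.
  have cS1 j : (j < M.+2)%N -> nth 0 sS j <= nth 0 s1 j.
    move=> jN; apply: (LE false false) BS B1 _ _ _ _ _ _ _ _ => //;
      rewrite ?addn0//.
    by rewrite ltW.
  (* At a2 = 1 / f_0 the second problem lives on the hyperplane where [endval] vanishes, which is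
     then the common subspace and has one eigenvalue fewer. *)
  have c12 j : (j < M.+2 - (a2 == 1 / f 0)%R)%N -> nth 0 s1 j <= nth 0 s2 j.
    move=> jN; apply: (LE (a2 == 1 / f 0) false) B1 B2 _ _ _ _ _ _ _ _ => //;
      rewrite ?subnn ?addn0 //.
    by rewrite implybb.
  (* On the hyperplane where [endval] vanishes the two forms agree; it has codimension one in the
     domain for [a3], hence the shift by one. *)
  have c23 j : (j < M.+1)%N -> nth 0 s2 j <= nth 0 s3 j.+1.
    move=> jN; apply: (LE true false) B2 B3 _ _ _ _ _ _ _ _ => //;
      rewrite ?implybT ?addn1 //.
  split; [|split].
  + move=> j jM; have jM1 := ltnW jM.
    by split; [exact: c34|split; [exact: c4S|split; [exact: cS1|]]];
      split; [apply/c12/ltn_subb | exact: c23].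
  + by split; [exact: c34|split; [exact: c4S|exact: cS1]].
  + by move=> lt2; apply: c12; rewrite lt_eqF.
- move=> a b1 b2 s1 s2 sS b12 L1 L2 LS.
  have B1 := bcA_realizes f z a b1; have B2 := bcA_realizes f z a b2.
  have BS := bcS2_realizes f z a.
  have c12 j : (j < M.+2 - (a == 1 / f 0)%R)%N -> nth 0 s1 j <= nth 0 s2 j.
    move=> jN; apply: (LE (a == 1 / f 0) false) B1 B2 _ _ _ _ _ _ _ _ => //;
      rewrite ?subnn ?addn0 ?orbb ?implybb ?ltW //.
  (* Restricting A(a, b) to x_N = 0 gives the form of S2 for every b. The domain of S2 is the common
     subspace, so there is no shift here; in [cS1] the larger domain is on the right and the index
     moves by one. *)
  have c2S j : (j < M.+1 - (a == 1 / f 0)%R)%N -> nth 0 s2 j <= nth 0 sS j.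
    move=> jN; apply: (LE (a == 1 / f 0) true) B2 BS _ _ _ _ _ _ _ _ => //;
      rewrite ?subnn ?addn0 ?orbb ?implybb ?addn1 ?subSS //.
  have cS1 j : (j < M.+1 - (a == 1 / f 0)%R)%N -> nth 0 sS j <= nth 0 s1 j.+1.
    move=> jN; apply: (LE (a == 1 / f 0) true) BS B1 _ _ _ _ _ _ _ _ => //;
      rewrite ?subnn ?addn0 ?orbb ?implybb ?addn1 //.
    by rewrite subSn ?ltnS // (leq_trans (leq_b1 _)).
  split; [|split].
  + move=> j jM.
    split; first by apply/c12/ltn_subb/ltnW.
    by split; [apply/c2S/ltn_subb | apply/cS1/ltn_subb].
  + exact/c12/ltn_subb.
  + move=> /negPf na; rewrite na in c12 c2S cS1.
    by split; [exact: c2S | split; [exact: cS1 | exact: c12]].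
Qed.
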